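(* Let $k\geq 1$ be an integer, let $f\in\mathbb{Z}[x_1,\dots,x_k]$, and let $\varepsilon\in\{1,-1\}$. Let $\{a_n\}_{n=0}^{\infty}$ be a sequence of integers satisfying $$a_{n+k+1}=\varepsilon\, a_n+f(a_{n+1},\dots,a_{n+k})\qquad\text{for all } n\geq 0,$$ and assume that $\lim_{n\to\infty}|a_n|=\infty$. Then the sequence $\{a_n\}_{n=0}^{\infty}$ has infinitely many prime divisors.
   Context: A prime $p$ is called a prime divisor of a sequence of integers $\{a_n\}_{n=0}^{\infty}$ if $p\mid a_n$ for some $n$. *)

(* Defs.v *)
From mathcomp Require Import all_boot all_order all_algebra.
From mathcomp Require Import mpoly.
From mathcomp Require Import classical_sets cardinality filter.

Set Implicit Arguments.
Unset Strict Implicit.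
Unset Printing Implicit Defensive.

Import GRing.Theory Num.Theory.

(* A vanishing term makes every prime a prime divisor, since every p divides 0. *)
Definition prime_divisor (a : nat -> int) (p : nat) : Prop :=
  prime p /\ exists n : nat, (p%:Z %| a n)%Z.

(* Main.v *)
Require Import Defs.
From mathcomp Require Import all_boot all_order all_algebra.
From mathcomp Require Import mpoly.
From mathcomp Require Import classical_sets cardinality filter.

Import GRing.Theory Num.Theory.

Local Open Scope classical_set_scope.
Local Open Scope ring_scope.

(** Modulo any [m] the recurrence can be run backwards, because [eps] is a
    unit, so the sequence is purely periodic modulo [m] and [a n = a 0 %[mod m]]
    for arbitrarily large [n]. If all prime divisors were at most [B], take
    [m = |a 0| * (B + 2)!]: then [a n = c * a 0] with [c = 1 %[mod (B + 2)!]].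
    A prime factor of [c] would be a prime divisor of the sequence, hence a
    divisor of [(B + 2)!] and of [c - 1], which is absurd. So [|a n| = |a 0|]
    for arbitrarily large [n]. *)

(** Pigeonhole on the indices [N * i] with [i <= #|T|]: two values of [u] agree, and cancelling the
    smaller index leaves a return time that is a positive multiple of [N], hence at least [N]. *)
Lemma backward_injective_recurrent (T : finType) (u : nat -> T) :
  (forall i j, u i.+1 = u j.+1 -> u i = u j) ->
  forall N, exists2 n, (N <= n)%N & u n = u 0%N.
Proof.
move=> u_inj N.
have u_inj_add d : forall i j, u (i + d)%N = u (j + d)%N -> u i = u j.
  elim: d => [|d IHd] i j; first by rewrite !addn0.
  by rewrite !addnS => /u_inj/IHd.
have [/injectiveP g_inj|] :=
    boolP (injectiveb (fun i : 'I_#|T|.+1 => u (N * i)%N)).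
  by have := leq_card _ g_inj; rewrite card_ord ltnn.
case/injectivePn=> i [j neq_ij eq_ij].
wlog lt_ij: i j neq_ij eq_ij / (i < j)%N.
  move=> wlog_ij; have [/wlog_ij|lt_ji|/val_inj eq_ij'] := ltngtP i j.
  - exact.
  - by apply: (wlog_ij j i); rewrite // eq_sym.
  - by rewrite eq_ij' eqxx in neq_ij.
exists (N * (j - i))%N; first by rewrite leq_pmulr // subn_gt0.
apply: (u_inj_add (N * i)%N).
by rewrite -mulnDr subnK 1?ltnW // add0n.
Qed.

Lemma rmorph_meval_eq (R S : comNzRingType) (phi : {rmorphism R -> S}) (k : nat)
    (f : {mpoly R[k]}) (v w : 'I_k -> R) :
  (forall i, phi (v i) = phi (w i)) -> phi f.@[v] = phi f.@[w].
Proof.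
move=> eq_vw; rewrite !mevalE !rmorph_sum; apply: eq_bigr => m _.
rewrite !rmorphM !rmorph_prod; congr (_ * _); apply: eq_bigr => i _.
by rewrite !rmorphXn eq_vw.
Qed.

(** The bound on [m] matters: the modulus of ['Z_m] is [m] only when [1 < m]. *)
Lemma Zp_intr_eq0 (m : nat) (x : int) :
  (1 < m)%N -> x%:~R = 0 :> 'Z_m -> (m%:Z %| x)%Z.
Proof.
move=> m_gt1; rewrite {1}[x]intEsign rmorphM rmorph_sign /= => /eqP.
rewrite mulr_sign; case: ifP => _; rewrite ?oppr_eq0 => /eqP/(congr1 val);
  by rewrite -pmulrn [LHS]val_Zp_nat //= => /eqP; rewrite dvdzE.
Qed.

Lemma recurrence_mod (k : nat) (f : {mpoly int[k]}) (eps : int)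
    (heps : eps = 1 \/ eps = -1) (a : nat -> int)
    (hrec : forall n : nat,
      a (n + k + 1)%N = eps * a n + f.@[fun i : 'I_k => a (n + i + 1)%N])
    (m : nat) :
  (1 < m)%N ->
  forall N, exists2 n, (N <= n)%N & (m%:Z %| a n - a 0%N)%Z.
Proof.
move=> m_gt1 N.
(* The state is a window of [k + 1] consecutive residues, so it lives in a finite type. *)
pose u n := [ffun i : 'I_k.+1 => (a (n + i)%N)%:~R : 'Z_m].
have uP i j (t : 'I_k.+1) :
    u i = u j -> (a (i + t)%N)%:~R = (a (j + t)%N)%:~R :> 'Z_m.
  by move/ffunP/(_ t); rewrite !ffunE.
have [i j eq_ij|n le_Nn /(@uP _ _ ord0)] := backward_injective_recurrent _ u _ N.
  have eq_succ (t : nat) : (t <= k)%N ->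
      (a (i + t).+1)%:~R = (a (j + t).+1)%:~R :> 'Z_m.
    by rewrite -ltnS => lt_tk; have := uP _ _ (Ordinal lt_tk) eq_ij; rewrite !addSn.
  (* Consecutive windows overlap in all entries but entry 0, which is recovered by solving the
     recurrence for [a n], with [eps] its own inverse. *)
  apply/ffunP=> -[[|t] lt_tk]; rewrite !ffunE /=; last first.
    by rewrite !addnS; apply: eq_succ; rewrite ltnW.
  have eps_unit : eps * eps = 1 by case: heps => ->.
  have a_back n : a n = eps * (a (n + k).+1
      - f.@[fun i : 'I_k => a (n + i + 1)%N]).
    by rewrite -addn1 hrec addrK mulrA eps_unit mul1r.
  rewrite !addn0 (a_back i) (a_back j) !rmorphM !rmorphB /= eq_succ //.
  congr (_ * (_ - _)); apply: rmorph_meval_eq => t /=.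
  by rewrite !addn1 eq_succ // ltnW.
rewrite !addn0 => eq_a; exists n => //.
by apply: Zp_intr_eq0; rewrite // rmorphB /= eq_a subrr.
Qed.

Theorem theorem2p2 (k : nat) (hk : (1 <= k)%N) (f : {mpoly int[k]})
    (eps : int) (heps : eps = 1 \/ eps = -1) (a : nat -> int)
    (hrec : forall n : nat,
      a (n + k + 1)%N = eps * a n + f.@[fun i : 'I_k => a (n + i + 1)%N])
    (hlim : `|a n|%N @[n --> \oo] --> \oo) :
  infinite_set [set p : nat | prime_divisor a p].
Proof.
move=> /finite_seqP[s s_eq].
pose B := (\max_(p <- s) p)%N.
have leB p : prime p -> forall n, (p%:Z %| a n)%Z -> (p <= B)%N.
  move=> p_pr n p_dvd; have : [set` s] p by rewrite -s_eq; split=> //; exists n.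
  by move=> /= p_s; exact: (@leq_bigmax_seq _ s xpredT id).
have a0_neq0 : a 0%N != 0.
  apply/eqP=> a0; have [p lt_Bp p_pr] := prime_above B.
  by have := leB p p_pr 0%N; rewrite a0 dvdz0 leqNgt lt_Bp => /(_ isT).
have [|N _ aN] := hlim [set m | (`|a 0%N| < m)%N].
  by exists `|a 0%N|.+1.
(* The shift by 2 keeps the modulus above 1 even if [B = 0]. *)
have fact_gt1 : (1 < (B.+2)`!)%N by rewrite -[1%N]/(1`!) ltn_fact.
have m_gt1 : (1 < `|a 0%N| * (B.+2)`!)%N.
  by rewrite (leq_trans fact_gt1) // leq_pmull // absz_gt0.
have [n le_Nn m_dvd] := recurrence_mod k f eps heps a hrec _ m_gt1 N.
have /dvdzP[c ac] : (a 0%N %| a n)%Z.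
  rewrite -(subrK (a 0%N) (a n)) rpredD ?dvdzz //.
  by apply: dvdz_trans m_dvd; rewrite dvdzE /= dvdn_mulr.
have c_mod : ((B.+2)`!%:Z %| c - 1)%Z.
  move: m_dvd; rewrite ac -{2}[a 0%N]mul1r -mulrBl !dvdzE /= abszM mulnC.
  by rewrite dvdn_pmul2r // absz_gt0.
have := aN n le_Nn; rewrite /= ac abszM.
suff -> : `|c|%N = 1%N by rewrite mul1n ltnn.
apply/eqP/negPn/negP=> c_neq1.
have [p p_pr p_dvd] : exists2 p, prime p & (p %| `|c|)%N.
  (* If [c = 0], any prime divides it; 2 is chosen. *)
  case: `|c|%N c_neq1 => [|[|d]] // _; first by exists 2%N.
  by have [//|p p_pr p_dvd] := @pdivP d.+2; exists p.
have p_dvd_fact : (p %| (B.+2)`!)%N.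
  rewrite dvdn_fact // prime_gt0 //= (leq_trans (leB p p_pr n _)) 1?ltnW //.
  by rewrite ac dvdz_mulr.
have p_dvd_sub : (p%:Z %| c - 1)%Z by apply: dvdz_trans c_mod.
have : (p%:Z %| c - (c - 1))%Z by rewrite rpredB.
by rewrite subKr dvdzE /= dvdn1 => /eqP p1; rewrite p1 in p_pr.
Qed.
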